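(* For any tree $\mathcal T=\{\mathcal N\cup\{0\},\mathcal L\}$ whose root node $0$ has degree $1$, with direct child of $0$ indexed by $1$ and $a=x_{01}$, the inverse $X^{-1}$ of the reactance matrix $X$ has the explicit form $$X^{-1}=\mathbb L+\begin{bmatrix}1/a&0&\cdots\\0&0&\cdots\\\vdots&\vdots&\ddots\end{bmatrix},$$ i.e. $X^{-1}$ equals $\mathbb L$ plus the $n\times n$ matrix whose $(1,1)$ entry is $1/a$ and whose other entries are all $0$.
   Context: $\mathcal T$ is a tree with node set $\mathcal N\cup\{0\}$, $\mathcal N=\{1,\dots,n\}$, rooted at $0$, with set of lines (edges, viewed as undirected) $\mathcal L$; each line $(h,k)\in\mathcal L$ has reactance $x_{hk}=x_{kh}>0$. $\mathcal L_i\subseteq\mathcal L$ is the set of lines on the unique path from $0$ to $i$. The reactance matrix $X\in\mathbb R^{n\times n}$ is $X_{ij}=\sum_{(h,k)\in\mathcal L_i\cap\mathcal L_j}x_{hk}$, $i,j\in\mathcal N$. The inverse tree $\mathcal T'$ has the same nodes and lines as $\mathcal T$, with weight $1/x_{ij}$ on line $(i,j)$. $\mathbb L\in\mathbb R^{n\times n}$ is the weighted Laplacian matrix of $\mathcal T'$ with the root node $0$ removed: for $i,j\in\mathcal N$, $\mathbb L_{ij}=-1/x_{ij}$ if $i\ne j$ and $(i,j)\in\mathcal L$; $\mathbb L_{ii}=\sum_{k\in\mathcal N:(i,k)\in\mathcal L}1/x_{ik}$; and $\mathbb L_{ij}=0$ otherwise. *)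

(* Defs.v *)
From mathcomp Require Import all_boot all_order all_algebra.

Set Implicit Arguments.
Unset Strict Implicit.
Unset Printing Implicit Defensive.

Import Order.TTheory GRing.Theory Num.Theory.
Local Open Scope ring_scope.

Section Trees.
Variable V : finType.
Implicit Types (L : {set {set V}}) (r h k i : V) (p : seq V).

(* An undirected line (h,k) is the two-element set [set h; k] = [set k; h]. *)
Definition adj L : rel V := fun h k => [set h; k] \in L.

(* A ucycle on two nodes only goes back and forth along one line, so graph
   cycles are the ucycles with at least three nodes. *)
Definition is_tree L : Prop :=
  [/\ forall l, l \in L -> #|l| = 2,
      forall h k, connect (adj L) h k
    & forall c : seq V, (2 < size c)%N -> ~ ucycle (adj L) c].

Definition degree L h : nat := #|[set k | adj L h k]|.

(* The node sequence of a path without repeated nodes is r :: p. *)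
Definition is_simple_path L r i p : bool :=
  [&& path (adj L) r p, last r p == i & uniq (r :: p)].

(* In a tree the simple path from r to i exists and is unique, so the choice
   made by pick is determined; the length bound is only there to make the
   range of pick finite, and holds for every p with uniq (r :: p). *)
Definition tree_path L r i : seq V :=
  if [pick p : #|V|.-bseq V | is_simple_path L r i p] is Some p
  then val p else [::].

Definition path_lines L r i : {set {set V}} :=
  [set l in pairmap (fun h k => [set h; k]) r (tree_path L r i)].

End Trees.

(* Nodes are 'I_n.+1 with root ord0; the matrix index i : 'I_n, counted from 0,
   stands for the non-root node numbered i.+1. *)
Definition node (n : nat) (i : 'I_n) : 'I_n.+1 := lift ord0 i.

Section Matrices.
Variables (R : realFieldType) (n : nat).
Implicit Types (L : {set {set 'I_n.+1}}) (x w : {set 'I_n.+1} -> R).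

Definition reactance_mx L x : 'M[R]_n :=
  \matrix_(i, j) \sum_(l in path_lines L ord0 (node i)
                            :&: path_lines L ord0 (node j)) x l.

Definition inverse_weight x : {set 'I_n.+1} -> R := fun l => (x l)^-1.

(* The root is removed before the Laplacian is formed: a line joining i to the
   root does not contribute to the diagonal entry of i. *)
Definition reduced_laplacian L w : 'M[R]_n :=
  \matrix_(i, j)
    if i == j then \sum_(k < n | adj L (node i) (node k)) w [set node i; node k]
    else if adj L (node i) (node j) then - w [set node i; node j]
    else 0.

End Matrices.

(* Main.v *)
Require Import Defs.
From mathcomp Require Import all_boot all_order all_algebra.

(** Physically, column j of the reactance matrix is the vector of potentials
when a unit current enters the tree at j and leaves at the grounded root, and
the matrix of the theorem is the grounded Laplacian: since node 1 is the only
neighbour of the root, adding 1/a at its diagonal entry restores exactly the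
line that was lost when the root was removed.  Hence the product of the two
matrices is the identity.

To see this without circuit theory, extend column j to all nodes by
X_(h,j) = sum of x_l over the lines l of the path to j, each multiplied by the
indicator that l is also on the path to h; at the root this is 0.  Crossing a
line of the tree adds or removes just that line from the path to the current
node ([tree_path_adj], [path_lines_rcons]).  So for l = (p,c), with p the
parent of c, the function x_l * 1(l is on the path to h) varies across l only,
by x_l, and its Laplacian with weights 1/x is delta_c - delta_p
([laplacian_cut]).  Summing over the lines from the root r to j telescopes to
delta_j - delta_r ([laplacian_reactance]), which is delta_j away from the root.

The combinatorial input is that simple paths in a tree are unique
([simple_path_unique]), so that the path selected by [tree_path] can be
computed. *)

Import Order.TTheory GRing.Theory Num.Theory.
Local Open Scope ring_scope.

(** * Simple paths in a tree *)

Section TreePaths.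

Set Implicit Arguments.
Unset Strict Implicit.

Context (V : finType) (L : {set {set V}}) (L_tree : is_tree L).
Implicit Types (r h i j k : V) (p q : seq V) (l : {set V}).

Lemma adj_sym : symmetric (adj L).
Proof. by move=> h k; rewrite /adj setUC. Qed.

Lemma adj_neq h k : adj L h k -> h != k.
Proof.
case: L_tree => card2 _ _ /card2.
by rewrite cards2; case: eqP.
Qed.

(** Otherwise a simple path from k to k' avoiding i, closed up through i, would
be a cycle. *)
Lemma connected_neighbours_eq i k k' :
  adj L i k -> adj L i k' ->
  connect [rel u v | [&& adj L u v, u != i & v != i]] k k' -> k = k'.
Proof.
move=> ik ik' /connectP[p kp k'E].
move: kp k'E; case/shortenP=> q kq kq_uniq _ k'E.
have iNq : i \notin k :: q.
  rewrite inE negb_or adj_neq //=.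
  elim: q {kq_uniq k'E} k kq {ik} => //= v q IHq u /andP[/and3P[_ _ vi] vq].
  by rewrite inE negb_or eq_sym vi (IHq v).
case: q => [|v q] in kq kq_uniq k'E iNq; first exact: esym.
case: L_tree => _ _ /(_ [:: i, k, v & q] isT)[].
rewrite /ucycle cons_uniq iNq kq_uniq andbT /cycle.
rewrite rcons_path -[last i _]/(last k (v :: q)) -k'E adj_sym ik' andbT.
rewrite -[path _ _ _]/(adj L i k && path (adj L) k (v :: q)) ik andbT.
by apply: sub_path kq => u w /and3P[].
Qed.

Lemma simple_path_rcons r i k p :
  is_simple_path L r i (rcons p k) =
  [&& k == i, is_simple_path L r (last r p) p, adj L (last r p) k
    & k \notin r :: p].
Proof.
rewrite /is_simple_path rcons_path last_rcons -rcons_cons rcons_uniq eqxx.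
by case: (path _ _ _); case: (_ == i); case: (adj _ _ _);
  rewrite //= ?andbF // andbC.
Qed.

Lemma path_avoid_connect i r p :
  path (adj L) r p -> i \notin r :: p ->
  connect [rel u v | [&& adj L u v, u != i & v != i]] r (last r p).
Proof.
move=> rp iNp; apply/connectP; exists p => //.
elim: p r rp iNp => //= k p IHp r /andP[rk kp].
rewrite inE negb_or => /andP[ir iNp]; rewrite rk IHp // andbT eq_sym ir.
by move: iNp; rewrite inE negb_or eq_sym => /andP[].
Qed.

(** Induction from the far end: if the last lines of the two paths to i differed,
the nodes before i would be two neighbours of i, connected through r without
passing by i. *)
Lemma simple_path_unique r i p q :
  is_simple_path L r i p -> is_simple_path L r i q -> p = q.
Proof.
have nil_only s : is_simple_path L r r s -> s = [::].
  case/lastP: s => // s k; rewrite simple_path_rcons.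
  by case/and4P=> /eqP-> _ _; rewrite mem_head.
elim/last_ind: p i q => [|p k IHp] i q.
  by case/and3P=> _ /eqP<- _ /nil_only.
case/lastP: q => [|q k'].
  by move=> rp /and3P[_ /eqP ri _]; move: rp; rewrite -ri => /nil_only.
rewrite !simple_path_rcons => /and4P[/eqP-> rp pi iNp].
move=> /and4P[/eqP-> rq qi iNq].
suff pq : last r p = last r q by rewrite (IHp _ q rp) // pq.
have sym : connect_sym [rel u v | [&& adj L u v, u != i & v != i]].
  by apply: sym_connect_sym => u v /=; rewrite adj_sym [X in _ && X]andbC.
apply: (@connected_neighbours_eq i); rewrite 1?adj_sym //.
apply: (@connect_trans _ _ r); first rewrite sym.
  by apply: path_avoid_connect => //; case/and3P: rp.
by apply: path_avoid_connect => //; case/and3P: rq.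
Qed.

Lemma tree_path_simple r i : is_simple_path L r i (tree_path L r i).
Proof.
rewrite /tree_path; case: pickP => [p //|no_path].
case: L_tree => _ /(_ r i)/connectP[p rp iE] _.
move: rp iE; case/shortenP=> q rq rq_uniq _ iE.
have szq : (size q <= #|V|)%N.
  by have := max_card (mem (r :: q)); rewrite (card_uniqP rq_uniq) => /ltnW.
have /negP[] := negbT (no_path (Bseq szq)).
by rewrite /is_simple_path [path _ _ _]rq iE eqxx.
Qed.

Lemma tree_pathE r i p : is_simple_path L r i p -> tree_path L r i = p.
Proof. exact/simple_path_unique/tree_path_simple. Qed.

Lemma path_lines_root r : path_lines L r r = set0.
Proof.
rewrite /path_lines (@tree_pathE r r [::]); first by apply/setP=> l; rewrite !inE.
by rewrite /is_simple_path /= eqxx.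
Qed.

(** Of two adjacent nodes one is the parent of the other: if k is off the path to
i, the line (i,k) extends that path; if k is on it, the part of the path from k
to i is closed by the line (i,k), hence is that line alone. *)
Lemma tree_path_adj r i k : adj L i k ->
  (tree_path L r k = rcons (tree_path L r i) k
     /\ k \notin r :: tree_path L r i)
  \/ (tree_path L r i = rcons (tree_path L r k) i
     /\ i \notin r :: tree_path L r k).
Proof.
move=> ik; have ri := tree_path_simple r i.
have /and3P[ri_path /eqP ri_last ri_uniq] := ri.
have [kP|kNp] := boolP (k \in r :: tree_path L r i); last first.
  left; split=> //; apply: tree_pathE.
  by rewrite simple_path_rcons eqxx ri_last ik ri.
right.
set p := tree_path L r i in ri ri_path ri_last ri_uniq kP *.
case/splitPl def_p: {1}p / kP => [p1 p2 kE].
(* A longer p2 would make k :: p2 a cycle. *)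
have p2E : p2 = [:: i].
  move: ri_path ri_last ri_uniq; rewrite def_p cat_path last_cat kE -cat_cons.
  rewrite cat_uniq => /andP[_ kp2] iE /and3P[_ p1Np2 p2_uniq].
  have kNp2 : k \notin p2.
    by apply: contra p1Np2 => kp; apply/hasP; exists k; rewrite // -kE mem_last.
  case: p2 {def_p p1Np2} kp2 iE p2_uniq kNp2 => [_ /= iE|v p2].
    by rewrite iE in ik; have := adj_neq ik; rewrite eqxx.
  case: p2 => [_ /= -> //|w p2] kp2 iE p2_uniq kNp2.
  case: L_tree => _ _ /(_ [:: k, v, w & p2] isT)[].
  rewrite /ucycle cons_uniq kNp2 p2_uniq andbT /cycle.
  by rewrite rcons_path kp2 iE ik.
move: ri; rewrite def_p p2E cats1 simple_path_rcons kE.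
by case/and4P=> _ /tree_pathE-> _ iN.
Qed.

(** The last line of the path to k is new because k is, while both ends of a
line of the path to i lie on that path. *)
Lemma path_lines_rcons r i k :
    tree_path L r k = rcons (tree_path L r i) k ->
    k \notin r :: tree_path L r i ->
  path_lines L r k = [set i; k] |: path_lines L r i /\
  [set i; k] \notin path_lines L r i.
Proof.
rewrite /path_lines; have /and3P[_ /eqP iE _] := tree_path_simple r i.
move: (tree_path L r i) iE => p <- {i} -> kNp; split.
  by apply/setP=> l; rewrite !inE -cats1 pairmap_cat mem_cat orbC !inE.
rewrite inE; apply: contra kNp.
move: (last r p) => i ikp; suff : i \in r :: p /\ k \in r :: p by case.
have sub l : l \in pairmap (fun h k => [set h; k]) r p -> {subset l <= r :: p}.
  elim: p r {ikp} => //= v p IHp r; rewrite inE => /predU1P[->|/IHp lp] u.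
    by rewrite !inE => /orP[]->; rewrite ?orbT.
  by move/lp; rewrite !inE => ->; rewrite orbT.
by split; apply: (sub _ ikp); rewrite !inE eqxx ?orbT.
Qed.

End TreePaths.

(** * Laplacian of the path potentials *)

Section TreePotential.

Context (V : finType) (L : {set {set V}}) (L_tree : is_tree L).
Context (R : fieldType) (x : {set V} -> R).
Context (x_neq0 : forall l, l \in L -> x l != 0).

Definition laplacian (f : V -> R) (i : V) : R :=
  \sum_(k | adj L i k) (x [set i; k])^-1 * (f i - f k).

Lemma laplacianD f g i :
  laplacian (fun h => f h + g h) i = laplacian f i + laplacian g i.
Proof.
rewrite /laplacian -big_split /=; apply: eq_bigr => k _.
by rewrite -mulrDr opprD addrACA.
Qed.

(** The line (p,c) cuts the tree into the nodes whose path uses it and the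
others.  The function is constant on either side, so it varies across (p,c)
only, where its increment x_pc cancels the weight. *)
Lemma laplacian_cut r p c i : adj L p c ->
  tree_path L r c = rcons (tree_path L r p) c -> c \notin r :: tree_path L r p ->
  laplacian (fun h => x [set p; c] * ([set p; c] \in path_lines L r h)%:R) i =
  (i == c)%:R - (i == p)%:R.
Proof.
move=> pc cE cNp; have [Pc epNp] := path_lines_rcons L_tree cE cNp.
have pNc := adj_neq L_tree pc.
have epc : [set p; c] \in path_lines L r c by rewrite Pc !inE eqxx.
(* A line other than (p,c) does not separate the two sides of the cut. *)
have same j k : adj L j k -> [set j; k] != [set p; c] ->
    ([set p; c] \in path_lines L r j) = ([set p; c] \in path_lines L r k).
  move=> jk; rewrite eq_sym => jkNpc.
  have [[kE kN]|[jE jN]] := tree_path_adj L_tree r jk.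
    have [-> _] := path_lines_rcons L_tree kE kN.
    by rewrite in_setU1 (negPf jkNpc).
  have [-> _] := path_lines_rcons L_tree jE jN.
  by rewrite in_setU1 [[set k; j]]setUC (negPf jkNpc).
have xV : (x [set p; c])^-1 * x [set p; c] = 1 by rewrite mulVf ?x_neq0.
have zero j k : adj L j k -> [set j; k] != [set p; c] ->
    (x [set j; k])^-1 * (x [set p; c] * ([set p; c] \in path_lines L r j)%:R
      - x [set p; c] * ([set p; c] \in path_lines L r k)%:R) = 0.
  by move=> jk jkNpc; rewrite (same j k) // subrr mulr0.
rewrite /laplacian; have [->|iNc] := eqVneq i c.
  rewrite (bigD1 p) 1?adj_sym //= big1 => [|k /andP[ck kNp]].
    rewrite epc (negPf epNp) [[set c; p]]setUC mulr1 mulr0 subr0 addr0 xV.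
    by rewrite eq_sym (negPf pNc) subr0.
  apply: zero => //; apply: contra_neqN kNp => /eqP/setP/(_ p).
  by rewrite !inE eqxx (negPf pNc) => /eqP.
have [->|iNp] := eqVneq i p.
  rewrite (bigD1 c) //= big1 => [|k /andP[pk kNc]].
    by rewrite epc (negPf epNp) mulr1 mulr0 sub0r addr0 mulrN xV sub0r.
  apply: zero => //; apply: contra_neqN kNc => /eqP/setP/(_ c).
  by rewrite !inE eqxx orbT eq_sym (negPf pNc) => /eqP.
rewrite subrr big1 // => k ik; apply: zero => //; apply/eqP=> /setP/(_ i).
by rewrite !inE eqxx (negPf iNc) (negPf iNp).
Qed.

(** Induction along the path from r to j: its last line contributes
delta_c - delta_p by [laplacian_cut], so the sum telescopes. *)
Lemma laplacian_reactance r i j :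
  laplacian (fun h => \sum_(l in path_lines L r h :&: path_lines L r j) x l) i =
  (i == j)%:R - (i == r)%:R.
Proof.
(* Summing over the lines of the path to j, with an indicator for h, gives an
   index set that does not depend on h and grows by one line per step. *)
transitivity (laplacian (fun h =>
    \sum_(l in path_lines L r j) x l * (l \in path_lines L r h)%:R) i).
  have sumI h : \sum_(l in path_lines L r h :&: path_lines L r j) x l =
      \sum_(l in path_lines L r j) x l * (l \in path_lines L r h)%:R.
    rewrite setIC (eq_bigl _ _ (fun l => in_setI l _ _)) big_mkcondr /=.
    by apply: eq_bigr => l _; case: ifP; rewrite ?mulr1 ?mulr0.
  by apply: eq_bigr => k _; rewrite !sumI.
have := tree_path_simple L_tree r j.
move: (tree_path L r j) => s; elim/last_ind: s j => [|p c IHp] j.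
  case/and3P=> _ /eqP/= <- _; rewrite subrr /laplacian big1 // => k _.
  by rewrite path_lines_root // !big_set0 subrr mulr0.
rewrite simple_path_rcons => /and4P[/eqP <- rp pc cNp].
have pE := tree_pathE L_tree rp.
have cE : tree_path L r c = rcons (tree_path L r (last r p)) c.
  by rewrite pE; apply: (tree_pathE L_tree); rewrite simple_path_rcons eqxx rp pc.
have := cNp; rewrite -{1}pE => cNp'.
have [-> eN] := path_lines_rcons L_tree cE cNp'.
rewrite -[X in X - _](subrK (i == last r p)%:R) -addrA -IHp //.
rewrite -(laplacian_cut i pc cE cNp') -laplacianD.
by apply: eq_bigr => k _; rewrite !big_setU1.
Qed.

End TreePotential.

(** * Inverse of the reactance matrix *)

(** The diagonal entry of the reduced Laplacian has the same weights as its row,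
so each row acts by differences along the lines between non-root nodes. *)
Lemma mul_reduced_laplacian (R : realFieldType) (n m : nat)
    (L : {set {set 'I_n.+1}}) (w : {set 'I_n.+1} -> R) (Y : 'M[R]_(n, m)) i j :
  is_tree L ->
  (reduced_laplacian L w *m Y) i j =
  \sum_(k < n | adj L (node i) (node k))
    w [set node i; node k] * (Y i j - Y k j).
Proof.
move=> L_tree.
have adj_irr : adj L (node i) (node i) = false.
  by apply/negP=> /(adj_neq L_tree); rewrite eqxx.
rewrite mxE (bigD1 i) //= mxE eqxx mulr_suml big_mkcond [RHS]big_mkcond.
rewrite (bigD1 i) // [RHS](bigD1 i) //= adj_irr !add0r -big_split /=.
apply: eq_bigr => k kNi; rewrite mxE eq_sym (negPf kNi).
by case: ifP; rewrite ?mul0r ?addr0 // mulrBr mulNr.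
Qed.

Theorem lemma6 (R : realFieldType) (n : nat)
    (L : {set {set 'I_n.+2}}) (x : {set 'I_n.+2} -> R) (a : R)
    (L_tree : is_tree L)
    (x_gt0 : forall l, l \in L -> 0 < x l)
    (root_deg1 : degree L ord0 = 1%N)
    (root_child : adj L ord0 (node (ord0 : 'I_n.+1)))
    (a_def : a = x [set ord0; node (ord0 : 'I_n.+1)]) :
  reactance_mx L x \in unitmx /\
  invmx (reactance_mx L x) =
    reduced_laplacian L (inverse_weight x)
    + \matrix_(i < n.+1, j < n.+1)
        (if (i == ord0) && (j == ord0) then 1 / a else 0).
Proof.
set X := reactance_mx L x; set M := (X in _ /\ _ = X).
suff MX : M *m X = 1%:M.
  have [_ Xunit] := mulmx1_unit MX; split=> //.
  by rewrite -[LHS]mul1mx -MX mulmxK.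
have x_neq0 l : l \in L -> x l != 0 by move=> /x_gt0; rewrite lt0r => /andP[].
have root_adj i : adj L (node i) ord0 = (i == ord0).
  have /cards1P[c cE] := introT eqP root_deg1.
  have only k : adj L ord0 k = (k == c) by have /setP/(_ k) := cE; rewrite !inE.
  rewrite adj_sym only; move: root_child; rewrite only => /eqP <-.
  exact: (inj_eq lift_inj).
apply/matrixP=> i j; rewrite mulmxDl mxE mul_reduced_laplacian // [RHS]mxE.
have := laplacian_reactance L_tree x_neq0 ord0 (node i) (node j).
rewrite (inj_eq lift_inj) subr0 => <-.
rewrite /laplacian [RHS]big_mkcond [RHS]big_ord_recl root_adj path_lines_root //.
(* The line to the root, at which the potential is 0, gives the 1/a term. *)
rewrite set0I big_set0 subr0 addrC; congr (_ + _).
  have [->|iN0] := eqVneq i ord0.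
    rewrite mxE (bigD1 ord0) //= big1 => [|k kN0]; last first.
      by rewrite mxE (negPf kN0) andbF mul0r.
    by rewrite !mxE eqxx /= a_def div1r addr0 setUC.
  by rewrite mxE big1 // => k _; rewrite mxE (negPf iN0) mul0r.
by rewrite big_mkcond; apply: eq_bigr => k _; rewrite !mxE.
Qed.
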